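(* Let $F=G+H$ be as in the context, where each $h_j:\mathbb{R}^n\to\mathbb{R}$ is continuously differentiable, each $g_j:\mathbb{R}^n\to\mathbb{R}\cup\{+\infty\}$ is proper, convex and lower semicontinuous, and $\mathrm{dom}(G)$ is convex and compact. Assume in addition that, for every $j\in\mathcal{J}$, $\nabla h_j$ is Lipschitz continuous with constant $L_j>0$, and let $L=\max_{j\in\mathcal{J}}L_j$. Let $(x^k)_{k\in\mathbb{N}}$ be an infinite sequence generated by the generalized conditional gradient method with the adaptive step size (so that $\theta(x^k)<0$ for all $k$). Then: (i) $\lim_{k\to\infty}\theta(x^k)=0$; (ii) for every positive integer $N$, $$\min\{|\theta(x^k)|: k=0,1,\dots,N-1\}\le\max\left\{\frac{2}{N}\big(f_{j^*}(x^0)-f_{j^*}^{\inf}\big),\ \Omega\sqrt{\frac{2L}{N}\big(f_{j^*}(x^0)-f_{j^*}^{\inf}\big)}\right\}.$$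
   Context: $\mathcal{J}=\{1,\dots,m\}$, $\mathbb{N}=\{0,1,2,\dots\}$, $\|\cdot\|$ is the Euclidean norm. $F=(f_1,\dots,f_m)$, $f_j=g_j+h_j$, $G=(g_1,\dots,g_m)$, $H=(h_1,\dots,h_m)$, $\mathrm{dom}(G)=\{x\in\mathbb{R}^n: g_j(x)<+\infty\text{ for all }j\in\mathcal{J}\}$. For $x\in\mathrm{dom}(G)$, $\theta(x):=\min_{u\in\mathbb{R}^n}\max_{j\in\mathcal{J}}\big(g_j(u)-g_j(x)+\langle\nabla h_j(x),u-x\rangle\big)\le 0$, and $p(x)\in\mathrm{dom}(G)$ denotes a point $u$ attaining this minimum. Generalized conditional gradient method: choose $x^0\in\mathrm{dom}(G)$; for $k=0,1,\dots$ compute a minimizer $p(x^k)$ and the value $\theta(x^k)$; stop if $\theta(x^k)=0$; otherwise compute a step size $\lambda_k\in(0,1]$ and set $x^{k+1}:=x^k+\lambda_k(p(x^k)-x^k)$. Adaptive step size: $\lambda_k:=\min\Big\{1,\dfrac{|\theta(x^k)|}{L\|p(x^k)-x^k\|^2}\Big\}$. Constants: $\Omega>0$ is a fixed number with $\Omega\ge\mathrm{diam}(\mathrm{dom}(G))$; $f_{j^*}(x^0):=\max\{f_j(x^0): j\in\mathcal{J}\}$ and $f_{j^*}^{\inf}:=\min\{f_j^*: j\in\mathcal{J}\}$, where $f_j^*:=\inf\{f_j(x): x\in\mathrm{dom}(G)\}$. *)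

(* Defs.v *)
(* MathComp-Analysis.  Points of R^n are row vectors 'rV[R]_n.                *)
From mathcomp Require Export all_boot all_order all_algebra.
From mathcomp Require Export all_classical all_reals all_analysis.

Set Implicit Arguments.
Unset Strict Implicit.
Unset Printing Implicit Defensive.

Import Order.TTheory GRing.Theory Num.Theory.
Import numFieldNormedType.Exports.

Local Open Scope classical_set_scope.
Local Open Scope ring_scope.

Section Euclidean.
Context {R : realType} {n : nat}.
Implicit Types (u v x : 'rV[R]_n) (f : 'rV[R]_n -> R).

Definition dotv u v : R := \sum_(i < n) u 0 i * v 0 i.

(* The library norm `|u| on matrices is the sup norm; it is equivalent to     *)
(* enorm, so compactness, continuity and differentiability are unaffected.    *)
Definition enorm u : R := Num.sqrt (dotv u u).

Definition ediam (A : set 'rV[R]_n) : \bar R :=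
  ereal_sup [set (enorm (z.1 - z.2))%:E | z in A `*` A].

Definition grad f x : 'rV[R]_n := \row_(i < n) 'D_(delta_mx 0 i) f x.

Definition continuously_differentiable f :=
  (forall x, differentiable f x) /\ continuous (grad f).

Definition grad_lipschitz (l : R) f :=
  forall x y, enorm (grad f x - grad f y) <= l * enorm (x - y).

End Euclidean.

Section Extended.
Context {R : realType} {n : nat}.
Local Open Scope ereal_scope.
Implicit Type g : 'rV[R]_n -> \bar R.

Definition proper_efun g := (forall x, g x != -oo) /\ exists x, g x < +oo.

(* At t = 0 and t = 1 this relies on 0 * +oo = 0, under which the inequality  *)
(* is trivial.                                                                *)
Definition convex_efun g := forall (x y : 'rV[R]_n) (t : R), (0 <= t <= 1)%R ->
  g (t *: x + (1 - t) *: y)%R <= t%:E * g x + (1 - t)%:E * g y.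

End Extended.

Section CompositeMultiobjective.
Context {R : realType} {n m : nat}.
Variables (g : 'I_m -> 'rV[R]_n -> \bar R) (h : 'I_m -> 'rV[R]_n -> R).
Local Open Scope ereal_scope.

Definition objective (j : 'I_m) (x : 'rV[R]_n) : \bar R := g j x + (h j x)%:E.

Definition domG : set 'rV[R]_n := [set x | forall j, g j x < +oo].

Definition subproblem (x u : 'rV[R]_n) : \bar R :=
  \big[maxe/-oo]_(j < m)
    (g j u - g j x + (dotv (grad (h j) x) (u - x)%R)%:E).

(* The minimum value; it is attained as soon as a subproblem_sol exists.      *)
Definition theta (x : 'rV[R]_n) : \bar R := ereal_inf (range (subproblem x)).

Definition subproblem_sol (x p : 'rV[R]_n) :=
  forall u, subproblem x p <= subproblem x u.

(* An infinite run: the stopping test theta = 0 never succeeds.  The choice   *)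
(* p k of a minimizer at x k need not be a function of the point x k.         *)
Definition gcg_run (x p : nat -> 'rV[R]_n) (lambda : nat -> R) :=
  domG (x 0%N) /\
  forall k, [/\ subproblem_sol (x k) (p k),
                theta (x k) != 0,
                (0 < lambda k <= 1)%R &
                x k.+1 = (x k + lambda k *: (p k - x k))%R].

Definition adaptive_step (L : R) (x p : nat -> 'rV[R]_n) (lambda : nat -> R) :=
  forall k, (lambda k)%:E =
    mine 1 (`|theta (x k)| / (L * enorm (p k - x k) ^+ 2)%:E).

Definition max_objective (x : 'rV[R]_n) : \bar R :=
  \big[maxe/-oo]_(j < m) objective j x.

Definition min_inf_objective : \bar R :=
  \big[mine/+oo]_(j < m) ereal_inf [set objective j x | x in domG].

End CompositeMultiobjective.

(* Main.v *)
Require Import Defs.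
From mathcomp Require Import ring lra.

(** Each iteration lowers every objective f_j = g_j + h_j by at least an amount
    that depends on t_k = |theta(x^k)| alone.  Write d = p(x^k) - x^k, lambda for
    the step.  Convexity bounds the increase of g_j by lambda (g_j(p) - g_j(x)),
    and the Lipschitz gradient bounds that of h_j by lambda <grad h_j(x), d> +
    (L/2) lambda^2 |d|^2 ([descent_lemma]).  Since theta(x) is the maximum over j
    of g_j(p) - g_j(x) + <grad h_j(x), d>, f_j drops by at least
    lambda t_k - (L/2) lambda^2 |d|^2 ([objective_decrease]).  The adaptive
    lambda maximizes this concave quadratic over [0, 1]; with |d| <= Omega its
    maximum is at least min (t_k / 2, t_k^2 / (2 L Omega^2))
    ([adaptive_step_decrease]).

    A lower semicontinuous function that avoids -oo is bounded below on a compact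
    set ([compact_lsc_lower_bound]), so f_j(x^k) is nonincreasing and bounded
    below.  Its consecutive differences vanish, which forces t_k to 0
    ([step_decrease_cvg0]).  Telescoping over N steps, one of the N decreases is
    at most (f_j(x^0) - inf f_j) / N; solving min (t / 2, t^2 / c) <= D / N for t
    gives the rate ([step_decrease_rate]).  Any single j serves, because
    f_j(x^0) - inf f_j <= max_i f_i(x^0) - min_i inf f_i and both terms of the
    bound increase with this gap. *)

Set Implicit Arguments.
Unset Strict Implicit.
Unset Printing Implicit Defensive.

Import Order.TTheory GRing.Theory Num.Theory.
Import numFieldNormedType.Exports.

Local Open Scope classical_set_scope.
Local Open Scope ring_scope.

(** * Euclidean inner product and the descent lemma *)

Section Euclid.
Context {R : realType} {n : nat}.
Implicit Types (u v w x : 'rV[R]_n) (f : 'rV[R]_n -> R).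

Lemma dotvC u v : dotv u v = dotv v u.
Proof. by apply: eq_bigr => i _; rewrite mulrC. Qed.

Lemma dotvDl u v w : dotv (u + v) w = dotv u w + dotv v w.
Proof. by rewrite -big_split; apply: eq_bigr => i _; rewrite mxE mulrDl. Qed.

Lemma dotvZl a u v : dotv (a *: u) v = a * dotv u v.
Proof. by rewrite mulr_sumr; apply: eq_bigr => i _; rewrite mxE mulrA. Qed.

Lemma dotvBl u v w : dotv (u - v) w = dotv u w - dotv v w.
Proof. by rewrite -scaleN1r dotvDl dotvZl mulN1r. Qed.

Lemma dotv_ge0 u : 0 <= dotv u u.
Proof. by apply: sumr_ge0 => i _; rewrite -expr2 sqr_ge0. Qed.

Lemma enorm_ge0 u : 0 <= enorm u.
Proof. exact: sqrtr_ge0. Qed.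

Lemma enorm_sqr u : enorm u ^+ 2 = dotv u u.
Proof. by rewrite sqr_sqrtr // dotv_ge0. Qed.

Lemma enorm0_eq0 u : enorm u = 0 -> u = 0.
Proof.
move=> u0; have /eqP := enorm_sqr u.
rewrite u0 expr0n /= eq_sym psumr_eq0 => [/allP z|i _]; last first.
  by rewrite -expr2 sqr_ge0.
apply/rowP => i; rewrite mxE; apply/eqP.
by have := z i (mem_index_enum _); rewrite /= -expr2 sqrf_eq0.
Qed.

Lemma enormZ a u : 0 <= a -> enorm (a *: u) = a * enorm u.
Proof.
move=> a0; rewrite /enorm dotvZl dotvC dotvZl mulrA -expr2.
by rewrite sqrtrM ?sqr_ge0 // sqrtr_sqr ger0_norm.
Qed.

(** For nonzero u and v, expand the square norm of |v| u - |u| v, which equals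
    2 |u| |v| (|u| |v| - <u, v>). *)
Lemma cauchy_schwarz u v : dotv u v <= enorm u * enorm v.
Proof.
have [u0|u0] := eqVneq (enorm u) 0.
  by rewrite u0 mul0r (enorm0_eq0 u0) -(scale0r 0) dotvZl mul0r.
have [v0|v0] := eqVneq (enorm v) 0.
  by rewrite v0 mulr0 dotvC (enorm0_eq0 v0) -(scale0r 0) dotvZl mul0r.
have uv0 : 0 < enorm u * enorm v by rewrite mulr_gt0 ?lt0r ?enorm_ge0 ?u0 ?v0.
have := dotv_ge0 (enorm v *: u - enorm u *: v).
rewrite dotvBl !dotvZl ![dotv _ (_ - _)]dotvC !dotvBl !dotvZl (dotvC v u).
rewrite -!enorm_sqr => H; rewrite -subr_ge0 -(pmulr_lge0 _ uv0); lra.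
Qed.

Lemma dotv_grad f x v : differentiable f x -> dotv (grad f x) v = 'D_v f x.
Proof.
move=> df; rewrite deriveE // [in RHS](row_sum_delta v) linear_sum.
by apply: eq_bigr => i _; rewrite linearZ /= mxE deriveE // mulrC.
Qed.

(** The difference quotient of s |-> f (x + s v) at t is literally the one that
    defines the derivative of f at x + t v in the direction v, so no chain rule
    is involved. *)
Lemma is_derive_along_line f x v (t : R) : differentiable f (x + t *: v) ->
  is_derive t 1 (fun s : R => f (x + s *: v)) (dotv (grad f (x + t *: v)) v).
Proof.
move=> df; rewrite dotv_grad //.
have E : (fun s => s^-1 *: (f (s *: v + (x + t *: v)) - f (x + t *: v))) =
         (fun s => s^-1 *: (f (x + (s *: 1 + t) *: v) - f (x + t *: v))).
  apply/funext => s; congr (_ *: (f _ - _)).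
  by rewrite addrCA scalerDl /GRing.scale /= mulr1.
have dd : derivable f (x + t *: v) v by exact: diff_derivable.
split; first by rewrite /derivable -E.
by rewrite /derive -E.
Qed.

(** The gap [psi] between f and its quadratic upper model along the segment has
    derivative <grad f (x + s v) - grad f x, v> - l s |v|^2, which Cauchy-Schwarz
    and the Lipschitz bound make nonpositive; hence psi 1 <= psi 0. *)
Lemma descent_lemma f (l : R) x v : (forall y, differentiable f y) ->
  0 <= l -> grad_lipschitz l f ->
  f (x + v) <= f x + dotv (grad f x) v + l / 2 * enorm v ^+ 2.
Proof.
move=> df l0 lip.
pose psi (s : R) := f (x + s *: v) - s * dotv (grad f x) v
   - l / 2 * enorm v ^+ 2 * s ^+ 2.
pose dpsi (s : R) := dotv (grad f (x + s *: v)) v - dotv (grad f x) v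
   - l * enorm v ^+ 2 * s.
have dpsiE (s : R) : is_derive s 1 psi (dpsi s).
  have D := is_derive_along_line (df (x + s *: v)).
  apply: is_derive_eq; rewrite /dpsi /GRing.scale /=; lra.
have [|c c01] := @MVT R psi dpsi 0 1 ltr01 (fun s _ => dpsiE s).
  apply: derivable_within_continuous => s _; exact: ex_derive.
rewrite subr0 mulr1 => E.
suff : dpsi c <= 0.
  rewrite -E /psi scale1r scale0r addr0; lra.
move: c01; rewrite in_itv /= => /andP[c0 c1].
rewrite /dpsi -dotvBl.
have := cauchy_schwarz (grad f (x + c *: v) - grad f x) v.
have := ler_wpM2r (enorm_ge0 v) (lip (x + c *: v) x).
rewrite addrAC subrr add0r (enormZ _ (ltW c0)).
lra.
Qed.
End Euclid.

(** * Real sequences with a guaranteed decrease *)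

Section RealRate.
Context {R : realType}.

(** With c = 2 L Omega^2 and t = |theta|: the first term is what a full step
    guarantees, the second what a step of length t / (L |d|^2) does. *)
Definition step_decrease (c t : R) : R := Num.min (t / 2) (t ^+ 2 / c).

Lemma step_decrease_ge0 (c t : R) : 0 < c -> 0 <= t -> 0 <= step_decrease c t.
Proof.
by move=> c0 t0; rewrite le_min !divr_ge0 ?sqr_ge0 ?(ltW c0).
Qed.

Lemma step_decrease_homo (c : R) : 0 < c ->
  {in Num.nneg &, {homo step_decrease c : s t / s <= t}}.
Proof.
move=> c0 s t s0 t0 st; rewrite le_min !ge_min.
by rewrite !ler_pM2r ?invr_gt0 // st ler_pXn2r // st orbT.
Qed.

(** If the step is 1 then t >= L d^2, so the quadratic term costs at most half of
    t; otherwise the step is the unconstrained maximizer t / (L d^2) and the gain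
    is exactly t^2 / (2 L d^2). *)
Lemma adaptive_step_decrease (L Omega t d lam : R) : 0 < L -> 0 < t ->
  0 < d -> d <= Omega -> lam = Num.min 1 (t / (L * d ^+ 2)) ->
  step_decrease (2 * L * Omega ^+ 2) t <= lam * t - L / 2 * (lam * d) ^+ 2.
Proof.
move=> L0 t0 d0 dO ->; have q0 : 0 < L * d ^+ 2 by rewrite mulr_gt0 ?exprn_gt0.
rewrite /step_decrease; case: (leP 1 (t / (L * d ^+ 2))) => [le1|_].
  rewrite ler_pdivlMr // mul1r in le1.
  rewrite ge_min; apply/orP; left; rewrite !mul1r; lra.
rewrite ge_min; apply/orP; right.
have -> : t / (L * d ^+ 2) * t - L / 2 * (t / (L * d ^+ 2) * d) ^+ 2
   = t ^+ 2 / (2 * L * d ^+ 2).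
  by field; rewrite !gt_eqF.
have O0 : 0 < Omega by exact: lt_le_trans dO.
rewrite ler_pM2l ?exprn_gt0 // lef_pV2 ?posrE ?mulr_gt0 ?exprn_gt0 //.
by rewrite ler_pM2l ?mulr_gt0 // ler_pXn2r // nnegrE ltW.
Qed.

Variables (a t : R^nat) (b c : R).
Hypotheses (c0 : 0 < c) (t0 : forall k, 0 <= t k) (ba : forall k, b <= a k).
Hypothesis dec : forall k, a k.+1 <= a k - step_decrease c (t k).

(** The differences a k - a k.+1 dominate [step_decrease c (t k)] and tend to 0,
    and [step_decrease c] is nondecreasing and positive at every e > 0. *)
Lemma step_decrease_cvg0 : t @ \oo --> 0.
Proof.
have a_cvg : cvgn a.
  apply: nonincreasing_is_cvgn; last by exists b => _ [k _ <-].
  apply/nonincreasing_seqP => k; apply: le_trans (dec k) _.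
  by rewrite gerBl step_decrease_ge0.
have diff0 : a k - a k.+1 @[k --> \oo] --> 0.
  rewrite -(subrr (limn a)); apply: cvgB => //.
  by rewrite (cvg_shiftS a).
apply/cvgrPdist_lt => e e0.
have de0 : 0 < step_decrease c e.
  by rewrite lt_min !divr_gt0 ?exprn_gt0.
near=> k.
rewrite sub0r normrN ger0_norm // ltNge; apply/negP => et.
have := step_decrease_homo c0 (ltW e0 : e \in Num.nneg) (t0 k) et.
suff : step_decrease c (t k) < step_decrease c e by rewrite ltNge => /negP.
apply: le_lt_trans (_ : a k - a k.+1 < _).
  by have := dec k; lra.
apply: le_lt_trans (ler_norm _) _; near: k.
by move/cvgr0Pnorm_lt : diff0; exact.
Unshelve. all: by end_near. Qed.

(** If every t k with k < N exceeded the bound, each of these N steps would lower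
    a by more than (a 0 - b) / N, and a N would fall below b. *)
Lemma step_decrease_rate N : (0 < N)%N -> exists2 k, (k < N)%N &
  t k <= Num.max (2 / N%:R * (a 0%N - b)) (Num.sqrt (c / N%:R * (a 0%N - b))).
Proof.
move=> N0; apply/not_exists2P => H.
set D := a 0%N - b in H.
have N0' : 0 < N%:R :> R by rewrite ltr0n.
have D0 : 0 <= D by rewrite subr_ge0.
have big k : (k < N)%N -> D / N%:R < step_decrease c (t k).
  move=> kN; case: (H k) => [/(_ kN) //|/negP].
  rewrite -ltNge gt_max => /andP[t1 t2].
  rewrite lt_min; apply/andP; split; first by lra.
  rewrite ltr_pdivlMr //.
  move: t2; rewrite -(@ltr_pXn2r _ 2) ?nnegrE ?sqrtr_ge0 // sqr_sqrtr.
    by lra.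
  by rewrite mulr_ge0 // divr_ge0 // ltW.
have sum k : (k < N)%N -> a k.+1 < a 0%N - k.+1%:R * (D / N%:R).
  elim: k => [|k IH] kN; first by have := dec 0; have := big _ kN; lra.
  have := dec k.+1; have := big _ kN; have := IH (ltnW kN).
  by rewrite -(natr1 k.+1); lra.
have /sum : (N.-1 < N)%N by rewrite prednK.
rewrite prednK // mulrC divfK ?gt_eqF // /D.
by have := ba N; lra.
Qed.
End RealRate.

(** * Lower bounds on compact sets *)

Section LowerBounds.
Context {T : topologicalType} {R : realType}.
Local Open Scope ereal_scope.

(** Each point has a neighborhood on which f > - i for all large i, and
    compactness makes one i work on all of K. *)
Lemma compact_lsc_lower_bound (K : set T) (f : T -> \bar R) : compact K ->
  lower_semicontinuous f -> (forall x, f x != -oo) ->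
  exists M : R, forall x, K x -> M%:E <= f x.
Proof.
move=> /compact_near_coveringP cK lscf fNy.
have {cK} := cK nat \oo (fun i x => (- i%:R)%:E < f x) _.
case=> [x Kx|N _ HN]; last first.
  by exists (- N%:R)%R => x Kx; apply/ltW/(HN N) => //=.
have [a xa] : exists a : R, a%:E < f x.
  case: (f x) (fNy x) => // [r|] _; last by exists 0%R; rewrite ltry.
  by exists (r - 1)%R; rewrite lte_fin ltrBlDr ltrDl.
have [V xV Va] := lscf x a xa.
exists (V, [set i | (- a <= i%:R)%R]).
  by split => //=; exact: nbhs_infty_ger.
move=> [y i] /= [Vy ai]; apply: le_lt_trans (Va y Vy).
by rewrite lee_fin lerNl.
Qed.

Lemma continuous_EFin_lsc (f : T -> R) :
  continuous f -> lower_semicontinuous (EFin \o f).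
Proof.
move=> cf x a; rewrite lte_fin => ax.
by exists [set y | (a < f y)%R] => //; exact: (cvgr_gt _ (cf x)).
Qed.

End LowerBounds.

(** * One iteration of the generalized conditional gradient method *)

Section Method.
Context {R : realType} {n m : nat}.
Variables (g : 'I_m -> 'rV[R]_n -> \bar R) (h : 'I_m -> 'rV[R]_n -> R).
Hypothesis m_gt0 : (0 < m)%N.
Hypothesis g_proper : forall j, proper_efun (g j).
Implicit Types (x p u : 'rV[R]_n) (j : 'I_m).

Definition fine_objective j x : R := fine (g j x) + h j x.

Lemma domG_fineE j x : domG g x -> (fine (g j x))%:E = g j x.
Proof.
move=> /(_ j) gx; apply: fineK.
by rewrite fin_numE (lt_eqF gx) andbT; have [] := g_proper j.
Qed.

Lemma objectiveE j x : domG g x -> objective g h j x = (fine_objective j x)%:E.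
Proof. by move=> gx; rewrite /objective -domG_fineE. Qed.

Local Open Scope ereal_scope.

Lemma subproblem_self_le0 x : domG g x -> subproblem g h x x <= 0.
Proof.
move=> gx; apply: bigmax_le => [|j _]; first exact: leNye.
rewrite -domG_fineE // -EFinB -EFinD lee_fin !subrr add0r.
by rewrite dotvC -(scale0r 0) dotvZl mul0r.
Qed.

Lemma theta_sol x p : subproblem_sol g h x p -> theta g h x = subproblem g h x p.
Proof.
move=> sol; apply/eqP; rewrite eq_le; apply/andP; split.
  by apply: ereal_inf_lbound; exists p.
by apply: le_ereal_inf_tmp => _ [u _ <-].
Qed.

(** A minimizer does at least as well as x itself, whose value is at most 0,
    whereas g_j p = +oo would make the value +oo. *)
Lemma subproblem_sol_domG x p :
  domG g x -> subproblem_sol g h x p -> domG g p.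
Proof.
move=> gx sol j; rewrite ltey; apply/eqP => gp.
have := le_trans (sol x) (subproblem_self_le0 gx).
move=> /(le_trans (le_bigmax -oo _ j)) /=.
by rewrite gp -domG_fineE.
Qed.

(** Finiteness from below is where at least one objective is required: an empty
    maximum is -oo. *)
Lemma theta_real x p : domG g x -> subproblem_sol g h x p ->
  theta g h x != 0 -> exists2 t : R, (0 < t)%R & theta g h x = (- t)%:E.
Proof.
move=> gx sol th0.
have gp := subproblem_sol_domG gx sol.
have : theta g h x < 0.
  rewrite lt_neqAle th0 (theta_sol sol).
  exact: le_trans (sol x) (subproblem_self_le0 gx).
have : -oo < theta g h x.
  rewrite (theta_sol sol); apply: lt_le_trans (le_bigmax -oo _ (Ordinal m_gt0)).
  by rewrite -(domG_fineE _ gx) -(domG_fineE _ gp) -EFinB -EFinD ltNyr.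
case: (theta g h x) => // r _; rewrite lte_fin => r0.
by exists (- r)%R; rewrite ?opprK ?oppr_gt0.
Qed.

Lemma linearized_decrease x p (t : R) j : domG g x -> subproblem_sol g h x p ->
  theta g h x = (- t)%:E ->
  (fine (g j p) - fine (g j x) + dotv (grad (h j) x) (p - x) <= - t)%R.
Proof.
move=> gx sol th; have gp := subproblem_sol_domG gx sol.
rewrite -lee_fin -th (theta_sol sol) EFinD EFinB !domG_fineE //.
exact: (le_bigmax -oo _ j).
Qed.

Hypothesis g_convex : forall j, convex_efun (g j).

Lemma fine_convex j x p (lam : R) : domG g x -> domG g p -> (0 <= lam <= 1)%R ->
  g j (x + lam *: (p - x))%R <=
    (fine (g j x) + lam * (fine (g j p) - fine (g j x)))%:E.
Proof.
move=> gx gp lam01.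
have := g_convex j p x lam01.
rewrite -(domG_fineE j gx) -(domG_fineE j gp) -!EFinM -EFinD.
have -> : (lam *: p + (1 - lam) *: x = x + lam *: (p - x))%R.
  by rewrite scalerBl scalerBr scale1r addrCA.
by move=> /le_trans; apply; rewrite lee_fin; lra.
Qed.

Lemma domG_step x p (lam : R) : domG g x -> domG g p -> (0 <= lam <= 1)%R ->
  domG g (x + lam *: (p - x))%R.
Proof.
by move=> gx gp lam01 j; apply: le_lt_trans (fine_convex j gx gp lam01) (ltry _).
Qed.

Variables (L : R).
Hypothesis L_ge0 : (0 <= L)%R.
Hypothesis h_diff : forall j x, differentiable (h j) x.
Hypothesis h_lip : forall j, grad_lipschitz L (h j).

(** The sum of the convexity bound for g_j, the quadratic bound for h_j, and
    lambda times the bound by theta on the linearized increment. *)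
Lemma objective_decrease j x p (lam t : R) : domG g x ->
  subproblem_sol g h x p -> theta g h x = (- t)%:E -> (0 <= lam <= 1)%R ->
  (fine_objective j (x + lam *: (p - x)) <=
   fine_objective j x - (lam * t - L / 2 * (lam * enorm (p - x)) ^+ 2))%R.
Proof.
move=> gx sol th lam01; have gp := subproblem_sol_domG gx sol.
have /andP[lam0 _] := lam01.
have := fine_convex j gx gp lam01.
rewrite -(domG_fineE j (domG_step gx gp lam01)) lee_fin.
have := descent_lemma x (lam *: (p - x)) (h_diff j) L_ge0 (h_lip j).
rewrite enormZ // dotvC dotvZl dotvC /fine_objective.
have := ler_wpM2l lam0 (linearized_decrease j gx sol th).
lra.
Qed.

End Method.

(** * Convergence and rate *)

Lemma grad_lipschitzW (R : realType) (n : nat) (f : 'rV[R]_n -> R) (l l' : R) :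
  l <= l' -> grad_lipschitz l f -> grad_lipschitz l' f.
Proof.
move=> ll' lip x y; apply: le_trans (lip x y) _.
by rewrite ler_wpM2r // enorm_ge0.
Qed.

Lemma enorm_ediam (R : realType) (n : nat) (A : set 'rV[R]_n) (Omega : R) x y :
  (ediam A <= Omega%:E)%E -> A x -> A y -> enorm (x - y) <= Omega.
Proof.
move=> dA Ax Ay; rewrite -lee_fin; apply: le_trans dA.
by apply: ereal_sup_ubound; exists (x, y).
Qed.

Local Open Scope ereal_scope.

Theorem proposition15 (R : realType) (n m : nat) (m_gt0 : (0 < m)%N)
  (g : 'I_m -> 'rV[R]_n -> \bar R) (h : 'I_m -> 'rV[R]_n -> R)
  (h_C1 : forall j, continuously_differentiable (h j))
  (g_proper : forall j, proper_efun (g j))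
  (g_convex : forall j, convex_efun (g j))
  (g_lsc : forall j, lower_semicontinuous (g j))
  (domG_convex : convex_set (domG g))
  (domG_compact : compact (domG g))
  (Lj : 'I_m -> R) (Lj_gt0 : forall j, (0 < Lj j)%R)
  (h_lip : forall j, grad_lipschitz (Lj j) (h j))
  (L : R) (L_def : L = (\big[Num.max/0]_(j < m) Lj j)%R)
  (Omega : R) (Omega_gt0 : (0 < Omega)%R)
  (Omega_diam : ediam (domG g) <= Omega%:E)
  (x p : nat -> 'rV[R]_n) (lambda : nat -> R)
  (run : gcg_run g h x p lambda)
  (step : adaptive_step g h L x p lambda) :
  (theta g h (x k) @[k --> \oo] --> 0) /\
  (forall N : nat, (0 < N)%N ->
     \big[mine/+oo]_(k < N) `|theta g h (x k)| <=
     maxe ((2 / N%:R)%:E * (max_objective g h (x 0%N) - min_inf_objective g h))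
          (Omega%:E *
           sqrte ((2 * L / N%:R)%:E *
                  (max_objective g h (x 0%N) - min_inf_objective g h)))).
Proof.
have [gx0 iter] := run.
have LjL j : (Lj j <= L)%R by rewrite L_def; exact: le_bigmax.
pose j0 := Ordinal m_gt0.
have L_gt0 : (0 < L)%R := lt_le_trans (Lj_gt0 j0) (LjL j0).
have lipL j : grad_lipschitz L (h j) := grad_lipschitzW (LjL j) (h_lip j).
have hdiff j u : differentiable (h j) u by have [] := h_C1 j.
have sol k : subproblem_sol g h (x k) (p k) by have [] := iter k.
have lam01 k : (0 <= lambda k <= 1)%R.
  by have [_ _ /andP[/ltW -> ->]] := iter k.
have xS k : x k.+1 = (x k + lambda k *: (p k - x k))%R by have [] := iter k.
have gx k : domG g (x k).
  elim: k => // k gxk; rewrite xS; apply: domG_step => //.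
  exact: subproblem_sol_domG (sol k).
have gp k : domG g (p k) := subproblem_sol_domG g_proper (gx k) (sol k).
have /choice[t t_spec] k :
    exists t : R, (0 < t)%R /\ theta g h (x k) = (- t)%:E.
  have [_ th0 _ _] := iter k.
  by have [t] := theta_real m_gt0 g_proper (gx k) (sol k) th0; exists t.
have t_gt0 k : (0 < t k)%R by have [] := t_spec k.
have thetaE k : theta g h (x k) = (- t k)%:E by have [] := t_spec k.
(* If p k = x k, every term of the subproblem vanishes, against theta < 0. *)
have d_gt0 k : (0 < enorm (p k - x k))%R.
  rewrite lt_neqAle enorm_ge0 andbT eq_sym; apply/eqP => /enorm0_eq0 /subr0_eq E.
  have := linearized_decrease g_proper j0 (gx k) (sol k) (thetaE k).
  by rewrite E !subrr add0r dotvC -(scale0r 0) dotvZl mul0r; have := t_gt0 k; lra.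
have lambdaE k :
    lambda k = Num.min 1%R (t k / (L * enorm (p k - x k) ^+ 2))%R.
  apply: EFin_inj; rewrite step thetaE EFin_min /= normrN gtr0_norm //.
  by rewrite inver gt_eqF // mulr_gt0 // exprn_gt0.
pose c := (2 * L * Omega ^+ 2)%R.
have c_gt0 : (0 < c)%R by rewrite !mulr_gt0 // exprn_gt0.
pose a k := fine_objective g h j0 (x k).
have a_dec k : (a k.+1 <= a k - step_decrease c (t k))%R.
  have dO := enorm_ediam Omega_diam (gp k) (gx k).
  have := objective_decrease g_proper g_convex (ltW L_gt0) hdiff lipL j0
    (gx k) (sol k) (thetaE k) (lam01 k).
  have := adaptive_step_decrease L_gt0 (t_gt0 k) (d_gt0 k) dO (lambdaE k).
  rewrite -xS /a /c; lra.
have [Mg Mg_le] : exists M : R, forall u, domG g u -> M%:E <= g j0 u.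
  apply: compact_lsc_lower_bound => // u; by have [] := g_proper j0.
have [Mh Mh_le] : exists M : R, forall u, domG g u -> M%:E <= (h j0 u)%:E.
  apply: compact_lsc_lower_bound => //; apply: continuous_EFin_lsc => u.
  exact: differentiable_continuous.
set I := ereal_inf [set objective g h j0 u | u in domG g].
have I_le k : I <= (a k)%:E.
  by apply: ereal_inf_lbound; exists (x k) => //; exact: objectiveE.
have I_ge : (Mg + Mh)%:E <= I.
  apply: le_ereal_inf_tmp => _ [u gu <-].
  by rewrite EFinD; apply: leeD; [exact: Mg_le|exact: Mh_le].
have IE : (fine I)%:E = I.
  apply: fineK; rewrite fin_numElt (lt_le_trans (ltNyr _) I_ge).
  exact: le_lt_trans (I_le 0%N) (ltry _).
have b_le k : (fine I <= a k)%R by rewrite -lee_fin IE.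
have t_ge0 k : (0 <= t k)%R := ltW (t_gt0 k).
split.
  have t0 := step_decrease_cvg0 c_gt0 t_ge0 b_le a_dec.
  under eq_fun do rewrite thetaE.
  apply: cvg_EFin; first exact: nearW.
  by rewrite -oppr0; exact: cvgN.
move=> N N_gt0.
have [k kN tk] := step_decrease_rate c_gt0 t_ge0 b_le a_dec N_gt0.
set D := max_objective g h (x 0%N) - min_inf_objective g h.
(* The extended gap D may a priori be +oo, since only the infimum of f_j0 is
   known to be finite; a lower bound on D suffices, by monotonicity. *)
have D_ge : (a 0%N - fine I)%:E <= D.
  rewrite EFinB IE; apply: leeB.
    by rewrite /a -objectiveE //; exact: (le_bigmax -oo _ j0).
  exact: (bigmin_le +oo j0).
have r_ge0 (s : R) : (0 <= s)%R -> (0 <= s / N%:R)%R by move=> s0; rewrite divr_ge0.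
have le_scaled (s : R) : (0 <= s)%R ->
    (s / N%:R * (a 0%N - fine I))%:E <= (s / N%:R)%:E * D.
  by move=> s0; rewrite EFinM lee_wpmul2l // lee_fin r_ge0.
apply: le_trans (bigmin_le +oo (Ordinal kN) _) _.
rewrite /= thetaE /= normrN ger0_norm //.
apply: (le_trans (y := _%:E)); first by rewrite lee_fin; exact: tk.
rewrite EFin_max; apply: le_max2; first exact: le_scaled.
have L2_ge0 : (0 <= 2 * L)%R by rewrite mulr_ge0 // ltW.
(* Extract Omega from the square root: c = 2 L Omega^2. *)
have -> : (c / N%:R * (a 0%N - fine I) =
           Omega ^+ 2 * (2 * L / N%:R * (a 0%N - fine I)))%R by rewrite /c; lra.
rewrite sqrtrM ?sqr_ge0 // sqrtr_sqr gtr0_norm // EFinM.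
rewrite lee_wpmul2l ?lee_fin ?(ltW Omega_gt0) //.
have := le_scaled _ L2_ge0; set y := (_ * _)%R => yD.
have y_ge0 : (0 <= y)%R by rewrite mulr_ge0 ?r_ge0 // subr_ge0.
change (sqrte y%:E <= sqrte ((2 * L / N%:R)%:E * D)).
by rewrite lee_sqrt // (le_trans _ yD) // lee_fin.
Qed.
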